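(* Let $\mathcal{A}_0$ and $\mathcal{A}_1$ be two generic complex line arrangements in $\mathbb{C}^2$ having the same combinatorics. Then $\mathcal{A}_0$ and $\mathcal{A}_1$ are topologically equivalent.
   Context: A complex line arrangement is a finite collection of (distinct) affine complex lines in $\mathbb{C}^2$; it is identified with the union of its lines. It is called generic if no three of its lines have a common point and not all of its lines are parallel. For a generic arrangement of $d$ lines with equations $a_ix+b_iy+c_i=0$ ($i=1,\dots,d$), the set of directions is $\{(a_i:b_i)\}_{i=1,\dots,d}\subset\mathbb{P}^1$; for each direction $\delta_j$ ($j=1,\dots,\ell$), let $p_j$ be the number of lines of the arrangement having direction $\delta_j$. The combinatorics of the arrangement is the list $(p_1,\dots,p_\ell)$, considered up to permutation (so $\sum_j p_j=d$). Two arrangements $\mathcal{A},\mathcal{A}'$ in $\mathbb{C}^2$ are topologically equivalent if there is a homeomorphism $\Phi:\mathbb{C}^2\to\mathbb{C}^2$ with $\Phi(\mathcal{A})=\mathcal{A}'$. *)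

(* Defs.v *)
From HB Require Import structures.
From mathcomp Require Import all_boot all_order all_algebra.
From mathcomp Require Import complex.
From mathcomp Require Import all_classical all_reals all_analysis.

Set Implicit Arguments.
Unset Strict Implicit.
Unset Printing Implicit Defensive.

Import Order.TTheory GRing.Theory Num.Theory.
Import numFieldNormedType.Exports.

Local Open Scope classical_set_scope.
Local Open Scope ring_scope.

(* Bare [R[i]] only carries algebraic and order structures.  Packaged as a
   [numClosedFieldType] it also receives the topology of its norm (the modulus)
   and is a one-dimensional space over itself; [C R * C R] is then the complex
   plane C^2 with the product topology, and a [vectType (C R)]. *)
Definition C (R : realType) : numClosedFieldType := R[i].

(* A line is given by an equation a x + b y + c = 0.  Proportional equations
   are different terms of this type but have the same [points]. *)
Record line (R : realType) := Line {
  la : C R;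
  lb : C R;
  lc : C R;
  line_nondegenerate : (la, lb) != (0, 0)
}.

Definition points (R : realType) (l : line R) : set (C R * C R) :=
  [set p | la l * p.1 + lb l * p.2 + lc l = 0].

(* The point (a : b) of the projective line P^1, as the one-dimensional subspace
   of C^2 spanned by (a, b). *)
Definition direction (R : realType) (l : line R) : {vspace C R * C R} :=
  <[(la l, lb l)]>%VS.

(* Distinctness is that of the lines as subsets of C^2, not of their
   equations. *)
Record arrangement (R : realType) := Arrangement {
  nlines : nat;
  lines : 'I_nlines -> line R;
  lines_distinct : injective (fun i => points (lines i))
}.

Arguments lines {R} A _ : rename.

Definition support (R : realType) (A : arrangement R) : set (C R * C R) :=
  \bigcup_(i : 'I_(nlines A)) points (lines A i).

Definition generic (R : realType) (A : arrangement R) : Prop :=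
  (forall i j k : 'I_(nlines A), uniq [:: i; j; k] ->
     points (lines A i) `&` points (lines A j) `&` points (lines A k) = set0)
  /\ ~ (forall i j : 'I_(nlines A),
          direction (lines A i) = direction (lines A j)).

Definition directions (R : realType) (A : arrangement R) :
    seq {vspace C R * C R} :=
  undup [seq direction (lines A i) | i : 'I_(nlines A)].

Definition combinatorics (R : realType) (A : arrangement R) : seq nat :=
  [seq #|[pred i : 'I_(nlines A) | direction (lines A i) == delta]|
     | delta <- directions A].

Definition same_combinatorics (R : realType) (A B : arrangement R) : bool :=
  perm_eq (combinatorics A) (combinatorics B).

Definition homeomorphism (X Y : topologicalType) (f : X -> Y) : Prop :=
  continuous f /\
  exists g : Y -> X, [/\ continuous g, cancel f g & cancel g f].

Definition topologically_equivalent (R : realType) (A B : arrangement R) :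
    Prop :=
  exists2 Phi : C R * C R -> C R * C R,
    homeomorphism Phi & Phi @` support A = support B.

(* Main.v *)
Require Import Defs.
From mathcomp Require Import all_boot all_order all_algebra.
From mathcomp Require Import complex.
From mathcomp Require Import all_classical all_reals all_analysis.
From mathcomp Require Import perm ring lra.
Set Implicit Arguments.
Unset Strict Implicit.
Unset Printing Implicit Defensive.
Import Order.TTheory GRing.Theory Num.Theory.
Import numFieldNormedType.Exports.
Local Open Scope classical_set_scope.
Local Open Scope ring_scope.

(** The two arrangements are joined by a family of arrangements with the same
combinatorics, and along such a family the homeomorphism type of the pair
(plane, arrangement) is locally constant.

After a linear change of coordinates, the shear (x, y) |-> (x + mu y, y) for a
suitable mu, the lines of both arrangements are graphs y = m_i x + c_i.
That the lines are distinct and no three of them concurrent then means that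
c_i <> c_k for parallel lines, and that on each L_i its intersections with the
lines not parallel to it, its nodes, are pairwise distinct
([admissible], [admissible_lines]). Equality of the combinatorics provides a
bijection between the lines of the two arrangements that preserves parallelism
([same_combinatorics_matching]).

The affine complex line t |-> (1 - t) P0 + t P1 through the two parameter
vectors leaves the admissible parameters at the roots of a nonzero polynomial in
t ([admissible_polynomial]); the real arc t = s + i lambda s (1 - s) joins 0 to
1 and misses all the roots once lambda is large ([arc_avoids_roots]).

It remains to see that nearby admissible parameters are equivalent
([local_triviality]). The homeomorphism is sought in the form id + h with h
Lipschitz of constant 1/2; every such map is a homeomorphism by the contraction
principle ([perturbation_homeomorphism]). On the line L_i the map h is forced up
to a reparametrization x |-> x + slide_i x of the line, where slide_i is a small sum of tent functions that carries each
node to its new position. These displacements agree at the nodes. They are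
Lipschitz with a small constant on the union of the lines, because two
intersecting lines diverge linearly from their node, and because parallel lines
stay at a definite distance while the parts of the displacement that depend on
the line, and not only on its slope, are bounded and small
([displacement_lipschitz_on_lines]). Finally each real coordinate of h extends
from the union of the lines to the plane with the same Lipschitz constant
([mcshane_extension]). *)

Local Notation Re := complex.Re.
Local Notation Im := complex.Im.

(** * Real modulus and distance on the complex plane *)

Section Modulus.
Variable R : realType.
Implicit Types (z w : C R) (p q : C R * C R).

(** The norm of [C R] takes its values in [C R]; estimates are carried out in [R]. *)
Definition modulus z : R := ComplexField.Normc.normc z.

Lemma normE z : `|z| = (modulus z)%:C%C.
Proof. by rewrite normc_def; case: z. Qed.

Lemma modulusM z w : modulus (z * w) = modulus z * modulus w.
Proof. exact: ComplexField.Normc.normcM. Qed.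

Lemma modulusN z : modulus (- z) = modulus z.
Proof. exact: normcN. Qed.

Lemma modulusD z w : modulus (z + w) <= modulus z + modulus w.
Proof. exact: le_normcD. Qed.

Lemma modulusB z w : modulus (z - w) <= modulus z + modulus w.
Proof. by rewrite -(modulusN w) modulusD. Qed.

Lemma modulus_ge0 z : 0 <= modulus z.
Proof. by case: z => a b; apply: sqrtr_ge0. Qed.

Lemma modulus0 : modulus 0 = 0.
Proof. exact: ComplexField.Normc.normc0. Qed.

Lemma modulus_gt0 z : (0 < modulus z) = (z != 0).
Proof.
rewrite lt_def modulus_ge0 andbT; congr (~~ _).
apply/eqP/eqP => [|->]; [exact: ComplexField.Normc.eq0_normc | exact: modulus0].
Qed.

Lemma modulus_dist z w : modulus (z - w) = modulus (w - z).
Proof. by rewrite -modulusN opprB. Qed.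

Lemma ler_modulus_add z v w : modulus (z - w) <= modulus (z - v) + modulus (v - w).
Proof. by have := modulusD (z - v) (v - w); rewrite addrA subrK. Qed.

Lemma modulus_real (x : R) : modulus (x%:C%C : C R) = `|x|.
Proof. by rewrite /modulus /= expr0n addr0 sqrtr_sqr. Qed.

Lemma modulus_sum (I : finType) (F : I -> C R) :
  modulus (\sum_i F i) <= \sum_i modulus (F i).
Proof.
elim/big_ind2: _ => [|a b c d h k|//]; first by rewrite modulus0.
exact: le_trans (modulusD _ _) (lerD h k).
Qed.

Lemma Re_le_modulus z : `|Re z| <= modulus z.
Proof. by have := normc_ge_Re z; rewrite (normE z) lecR. Qed.

Lemma Im_le_modulus z : `|Im z| <= modulus z.
Proof.
have := @Re_le_modulus (z * 'i%C).
have -> : modulus (z * 'i%C) = modulus z.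
  rewrite modulusM -[RHS]mulr1; congr (_ * _).
  by rewrite /modulus /= expr0n add0r expr1n sqrtr1.
by rewrite ReiNIm normrN.
Qed.

Lemma modulus_le_ReIm z : modulus z <= `|Re z| + `|Im z|.
Proof.
case: z => a b; rewrite /modulus /=.
rewrite -[leRHS]ger0_norm ?addr_ge0 // -sqrtr_sqr ler_wsqrtr //.
rewrite -(real_normK (num_real a)) -(real_normK (num_real b)).
by have := normr_ge0 a; have := normr_ge0 b; nra.
Qed.

Lemma ReB z w : Re (z - w) = Re z - Re w. Proof. by case: z w => a b []. Qed.
Lemma ImB z w : Im (z - w) = Im z - Im w. Proof. by case: z w => a b []. Qed.

(** The sum distance rather than the maximum: it keeps all the estimates linear. *)
Definition dist p q : R := modulus (p.1 - q.1) + modulus (p.2 - q.2).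

Lemma dist_ge0 p q : 0 <= dist p q.
Proof. by rewrite addr_ge0 ?modulus_ge0. Qed.

Lemma distC p q : dist p q = dist q p.
Proof. by rewrite /dist modulus_dist (modulus_dist p.2). Qed.

Lemma dist_triangle q p r : dist p r <= dist p q + dist q r.
Proof.
rewrite /dist; have := ler_modulus_add p.1 q.1 r.1.
by have := ler_modulus_add p.2 q.2 r.2; lra.
Qed.

Lemma dist_self p : dist p p = 0.
Proof. by rewrite /dist !subrr modulus0 addr0. Qed.

Lemma dist_le0_eq p q : dist p q <= 0 -> p = q.
Proof.
move=> d0; have e1 : modulus (p.1 - q.1) = 0.
  by move: d0; rewrite /dist; have := modulus_ge0 (p.1 - q.1);
     have := modulus_ge0 (p.2 - q.2); lra.
have e2 : modulus (p.2 - q.2) = 0.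
  by move: d0; rewrite /dist; have := modulus_ge0 (p.2 - q.2); lra.
case: p q e1 e2 {d0} => a b [c d] /= /ComplexField.Normc.eq0_normc/subr0_eq ->.
by move=> /ComplexField.Normc.eq0_normc/subr0_eq ->.
Qed.

Lemma norm_pair_lt p (e : C R) : (`|p| < e) = (`|p.1| < e) && (`|p.2| < e).
Proof. by rewrite prod_normE comparable_gt_max // real_comparable // normr_real. Qed.

Definition lipschitz_on_set (S : set (C R * C R)) (k : R)
    (h : C R * C R -> C R * C R) :=
  forall p q, S p -> S q -> dist (h p) (h q) <= k * dist p q.

(** The link between the real distance and the product topology, in which
balls have radii in [C R]: a positive element of [C R] is real. *)
Lemma lipschitz_continuous k h : lipschitz_on_set setT k h -> continuous h.
Proof.
move=> hk p; apply/cvgrPdist_lt => e e0.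
have eE : e = (Re e)%:C%C by rewrite -[LHS]RRe_real // gtr0_real.
have r0 : 0 < Re e by move: e0; rewrite {1}eE ltcR.
set d := Re e / (2 * (`|k| + 1)).
have k0 : 0 <= `|k| by [].
have d0 : 0 < d by rewrite /d divr_gt0 // mulr_gt0 // ltr_pwDr.
have dC0 : 0 < (d%:C%C : C R) by rewrite ltcR.
near=> q.
have pq : `|p - q| < d%:C%C.
  near: q; apply: cvgr_dist_lt dC0; exact: cvg_id.
have := hk p q I I.
move: pq; rewrite {1}eE !norm_pair_lt !normE !ltcR /= => /andP[h1 h2] H.
suff : dist (h p) (h q) < Re e.
  rewrite /dist => L; apply/andP; split; apply: le_lt_trans L.
    by rewrite lerDl modulus_ge0.
  by rewrite lerDr modulus_ge0.
apply: le_lt_trans H _; apply: (@le_lt_trans _ _ (`|k| * (d + d))).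
  apply: (le_trans (ler_wpM2r (dist_ge0 _ _) (ler_norm k))).
  by apply: ler_wpM2l => //; rewrite /dist; move: h1 h2 => /=; lra.
have -> : Re e = (`|k| + 1) * (d + d) by rewrite /d; field; rewrite gt_eqF // ltr_pwDr.
by rewrite mulrDl mul1r; lra.
Unshelve. all: by end_near.
Qed.

End Modulus.

Arguments modulus {R} z : simpl never.

(** * Lipschitz perturbations of the identity *)

Section Perturbation.
Variable R : realType.
Implicit Types (p q : C R * C R) (h : C R * C R -> C R * C R).

Lemma le0_geometric (x c : R) : (forall n, x <= c / 2 ^+ n) -> x <= 0.
Proof.
move=> xc; rewrite leNgt; apply/negP => x0.
have [c0|c0] := leP c 0.
  by have := xc 0%N; rewrite expr0 divr1; lra.
have [n nc] : exists n : nat, c / x < n%:R.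
  by exists (Num.bound (c / x)); apply: archi_boundP; rewrite divr_ge0 // ltW.
have := xc n; rewrite ler_pdivlMr ?exprn_gt0 // => H.
have n2 : (n%:R : R) <= 2 ^+ n by rewrite -natrX ler_nat ltnW // ltn_expl.
move: nc; rewrite ltr_pdivrMr // => nc.
have : x * n%:R <= x * 2 ^+ n by rewrite ler_pM2l.
by lra.
Qed.

(** Since [u n - 2 c / 2 ^ n] is nondecreasing and [u n + 2 c / 2 ^ n]
nonincreasing, the supremum of the former is a limit with explicit error. *)
Lemma geometric_limit (u : nat -> R) (c : R) :
  (forall n, `|u n.+1 - u n| <= c / 2 ^+ n) ->
  exists l, forall n, `|u n - l| <= 2 * c / 2 ^+ n.
Proof.
move=> uc.
have step n k : `|u n - u (n + k)%N| <= 2 * c / 2 ^+ n - 2 * c / 2 ^+ (n + k).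
  elim: k => [|k IH]; first by rewrite addn0 !subrr normr0.
  have -> : 2 * c / 2 ^+ n - 2 * c / 2 ^+ (n + k.+1) =
            2 * c / 2 ^+ n - 2 * c / 2 ^+ (n + k) + c / 2 ^+ (n + k).
    by rewrite addnS exprS; field; rewrite !expf_neq0 //.
  apply: le_trans (lerD IH (uc (n + k)%N)); rewrite -addnS.
  rewrite -[leLHS]opprK -normrN opprK.
  by apply: le_trans (ler_normB _ _); rewrite addnS; rewrite le_eqVlt; apply/orP; left;
     rewrite -normrN; apply/eqP; congr (`|_|); ring.
have c0 : 0 <= c by have := le_trans (normr_ge0 _) (uc 0%N); rewrite expr0 divr1.
have pos n : 0 <= 2 * c / 2 ^+ n by rewrite divr_ge0 ?mulr_ge0 ?exprn_ge0.
have ab n m : u n - 2 * c / 2 ^+ n <= u m + 2 * c / 2 ^+ m.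
  have [/subnKC <-|/ltnW/subnKC <-] := leqP n m.
    have := step n (m - n)%N; rewrite ler_norml => /andP[_].
    by have := pos (n + (m - n))%N; lra.
  have := step m (n - m)%N; rewrite ler_norml => /andP[].
  by have := pos (m + (n - m))%N; lra.
pose A := range (fun n => u n - 2 * c / 2 ^+ n).
have Aub : has_ubound A by exists (u 0%N + 2 * c / 2 ^+ 0) => _ [n _ <-]; exact: ab.
exists (sup A) => n; rewrite ler_norml; apply/andP; split.
  have : sup A <= u n + 2 * c / 2 ^+ n.
    apply: ge_sup; first by exists (u 0%N - 2 * c / 2 ^+ 0); exists 0%N.
    by move=> _ [m _ <-]; exact: ab.
  by lra.
have : u n - 2 * c / 2 ^+ n <= sup A by apply: ub_le_sup => //; exists n.
by lra.
Qed.

Lemma complex_geometric_limit (z : nat -> C R) (c : R) :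
  (forall n, modulus (z n.+1 - z n) <= c / 2 ^+ n) ->
  exists l, forall n, modulus (z n - l) <= 4 * c / 2 ^+ n.
Proof.
move=> zc.
have [n|a Ha] := @geometric_limit (fun n => Re (z n)) c.
  by rewrite -ReB; apply: le_trans (Re_le_modulus _) (zc n).
have [n|b Hb] := @geometric_limit (fun n => Im (z n)) c.
  by rewrite -ImB; apply: le_trans (Im_le_modulus _) (zc n).
exists (Complex a b) => n; apply: le_trans (modulus_le_ReIm _) _.
rewrite ReB ImB; apply: le_trans (lerD (Ha n) (Hb n)) _.
by rewrite le_eqVlt; apply/orP; left; apply/eqP; ring.
Qed.

Lemma dist_perturb p q a b : dist p q <= dist (p + a) (q + b) + dist a b.
Proof.
rewrite /dist /=.
have := modulusB (p.1 + a.1 - (q.1 + b.1)) (a.1 - b.1).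
have := modulusB (p.2 + a.2 - (q.2 + b.2)) (a.2 - b.2).
have -> : p.2 + a.2 - (q.2 + b.2) - (a.2 - b.2) = p.2 - q.2 by ring.
have -> : p.1 + a.1 - (q.1 + b.1) - (a.1 - b.1) = p.1 - q.1 by ring.
by lra.
Qed.

(** Contraction principle: the solutions of [p + h p = q] are the fixed points
of [p |-> q - h p], and the iterates of this map converge geometrically. *)
Lemma perturbation_surjective h : lipschitz_on_set setT 2^-1 h ->
  forall q, exists p, p + h p = q.
Proof.
move=> hL q; pose u n := iter n (fun p => q - h p) q.
have dN p p' : dist (q - h p) (q - h p') = dist (h p) (h p').
  rewrite /dist /= (modulus_dist (h p).1) (modulus_dist (h p).2).
  by congr (modulus _ + modulus _); ring.
pose D := dist (u 1%N) (u 0%N).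
have uD n : dist (u n.+1) (u n) <= D / 2 ^+ n.
  elim: n => [|n IH]; first by rewrite expr0 divr1.
  rewrite [u n.+2]/= [X in dist _ X]/= dN; apply: le_trans (hL _ _ I I) _.
  by rewrite exprS invfM mulrCA ler_pM2l // invr_gt0.
have [n|a Ha] := @complex_geometric_limit (fun n => (u n).1) D.
  by apply: le_trans (uD n); rewrite lerDl modulus_ge0.
have [n|b Hb] := @complex_geometric_limit (fun n => (u n).2) D.
  by apply: le_trans (uD n); rewrite lerDr modulus_ge0.
have up n : dist (u n) (a, b) <= 8 * D / 2 ^+ n.
  have -> : 8 * D / 2 ^+ n = 4 * D / 2 ^+ n + 4 * D / 2 ^+ n by ring.
  exact: lerD (Ha n) (Hb n).
move: (a, b) up => p up {Ha Hb}; exists p.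
suff E : p = q - h p by rewrite {1}E subrK.
apply: dist_le0_eq; apply: (@le0_geometric _ (8 * D)) => n.
apply: le_trans (@dist_triangle _ (u n.+1) _ _) _.
have {2}-> : u n.+1 = q - h (u n) by [].
rewrite dN distC; apply: le_trans (lerD (up _) (hL _ _ I I)) _.
have -> : 8 * D / 2 ^+ n = 8 * D / 2 ^+ n.+1 + 2^-1 * (8 * D / 2 ^+ n).
  by rewrite exprS; field; rewrite expf_neq0.
by rewrite lerD2l ler_pM2l ?invr_gt0.
Qed.

(** The triangle inequality gives [dist p q <= 2 dist (p + h p) (q + h q)],
hence injectivity and a 2-Lipschitz inverse. *)
Lemma perturbation_homeomorphism h : lipschitz_on_set setT 2^-1 h ->
  homeomorphism (fun p => p + h p).
Proof.
move=> hL.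
have expand p q : dist p q <= 2 * dist (p + h p) (q + h q).
  by have := dist_perturb p q (h p) (h q); have := hL p q I I; lra.
split.
  apply: (@lipschitz_continuous _ 2) => p q _ _; rewrite /dist /=.
  have := hL p q I I; rewrite /dist.
  have := modulusD (p.1 - q.1) ((h p).1 - (h q).1).
  have := modulusD (p.2 - q.2) ((h p).2 - (h q).2).
  have -> : p.1 + (h p).1 - (q.1 + (h q).1) = p.1 - q.1 + ((h p).1 - (h q).1) by ring.
  have -> : p.2 + (h p).2 - (q.2 + (h q).2) = p.2 - q.2 + ((h p).2 - (h q).2) by ring.
  have := modulus_ge0 (p.1 - q.1); have := modulus_ge0 (p.2 - q.2).
  by lra.
pose g q := projT1 (cid (perturbation_surjective hL q)).
have gK : cancel g (fun p => p + h p).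
  by move=> q; exact: projT2 (cid (perturbation_surjective hL q)).
exists g; split => //.
  apply: (@lipschitz_continuous _ 2) => p q _ _.
  by have := expand (g p) (g q); rewrite !gK.
move=> p; apply: dist_le0_eq; apply: le_trans (expand _ _) _.
by rewrite gK dist_self mulr0.
Qed.

(** McShane's formula: the infimum over [s] in [S] of the cones
[f s + k * dist s p] extends [f] without loss in the constant. *)
Lemma mcshane_extension (S : set (C R * C R)) (k : R) (f : C R * C R -> R) :
  0 <= k ->
  (forall p q, S p -> S q -> `|f p - f q| <= k * dist p q) ->
  exists2 F : C R * C R -> R, (forall p, S p -> F p = f p) &
    forall p q, `|F p - F q| <= k * dist p q.
Proof.
move=> k0 fk; have [[s0 S0]|S0] := pselect (S !=set0); last first.
  exists (fun=> 0) => [p Sp|p q]; first by exfalso; apply: S0; exists p.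
  by rewrite subrr normr0 mulr_ge0 ?dist_ge0.
pose A p := [set f s + k * dist s p | s in S].
have Alb t p : S t -> lbound (A p) (f t - k * dist t p).
  move=> St _ [s Ss <-]; have := fk t s St Ss; rewrite ler_norml => /andP[_].
  have := ler_wpM2l k0 (dist_triangle p t s); rewrite (distC p s) mulrDr.
  by lra.
have Ahas p : has_lbound (A p) by exists (f s0 - k * dist s0 p); exact: Alb.
have A0 p : A p !=set0 by exists (f s0 + k * dist s0 p); exists s0.
exists (fun p => inf (A p)) => [p Sp|p q].
  apply/eqP; rewrite eq_le; apply/andP; split.
    by apply: ge_inf => //; exists p => //; rewrite dist_self mulr0 addr0.
  by have := lb_le_inf (A0 p) (Alb p p Sp); rewrite dist_self mulr0 subr0.
have half x y : inf (A x) - k * dist x y <= inf (A y).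
  apply: lb_le_inf => // _ [s Ss <-].
  have : inf (A x) <= f s + k * dist s x by apply: ge_inf => //; exists s.
  by have := ler_wpM2l k0 (dist_triangle y s x); rewrite (distC y x) mulrDr; lra.
rewrite ler_norml; have := half p q; have := half q p; rewrite (distC q p).
by move=> *; apply/andP; split; lra.
Qed.

(** The factor 4 comes from extending the four real coordinates separately. *)
Lemma lipschitz_extension (S : set (C R * C R)) (k : R) h :
  0 <= k -> lipschitz_on_set S k h ->
  exists2 H, {in S, H =1 h} & lipschitz_on_set setT (4 * k) H.
Proof.
move=> k0 hk.
have ext (phi : C R * C R -> R) :
    (forall p q, `|phi (h p) - phi (h q)| <= dist (h p) (h q)) ->
    exists2 F : C R * C R -> R, (forall p, S p -> F p = phi (h p)) &
      forall p q, `|F p - F q| <= k * dist p q.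
  move=> phi1; apply: (@mcshane_extension S k (phi \o h)) => // p q Sp Sq.
  exact: le_trans (phi1 p q) (hk p q Sp Sq).
have [p q|F1 e1 l1] := ext (fun p => Re p.1).
  rewrite -ReB; apply: le_trans (Re_le_modulus _) _.
  by rewrite lerDl modulus_ge0.
have [p q|F2 e2 l2] := ext (fun p => Im p.1).
  rewrite -ImB; apply: le_trans (Im_le_modulus _) _.
  by rewrite lerDl modulus_ge0.
have [p q|F3 e3 l3] := ext (fun p => Re p.2).
  rewrite -ReB; apply: le_trans (Re_le_modulus _) _.
  by rewrite lerDr modulus_ge0.
have [p q|F4 e4 l4] := ext (fun p => Im p.2).
  rewrite -ImB; apply: le_trans (Im_le_modulus _) _.
  by rewrite lerDr modulus_ge0.
exists (fun p => (Complex (F1 p) (F2 p), Complex (F3 p) (F4 p))).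
  move=> p /set_mem Sp; rewrite e1 // e2 // e3 // e4 //.
  by case: (h p) => -[a b] [c d].
move=> p q _ _; have -> : 4 * k * dist p q =
  (k * dist p q + k * dist p q) + (k * dist p q + k * dist p q) by ring.
apply: lerD; apply: le_trans (modulus_le_ReIm _) _; rewrite ReB ImB.
  exact: lerD (l1 p q) (l2 p q).
exact: lerD (l3 p q) (l4 p q).
Qed.

(** The constant 8^-1 is the one that extends to a (1/2)-Lipschitz map. *)
Lemma ambient_homeomorphism (S : set (C R * C R)) h :
  lipschitz_on_set S 8^-1 h ->
  exists2 Phi, homeomorphism Phi & forall p, S p -> Phi p = p + h p.
Proof.
move=> /(lipschitz_extension (ltW _)) [|H Hh HL]; first by rewrite invr_gt0.
exists (fun p => p + H p) => [|p Sp]; last by rewrite Hh ?inE.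
apply: perturbation_homeomorphism; move=> p q _ _; apply: le_trans (HL p q I I) _.
have -> : 4 * 8^-1 = 2^-1 :> R by field.
by [].
Qed.

End Perturbation.

(** * Displacing finitely many points of the complex line *)

Section Bump.
Variables (R : realType) (J : finType) (P : pred J) (M : R) (a w : J -> C R).
Implicit Types (x y z : C R).

Definition tent z : R := Num.max 0 (1 - M * modulus z).

(** The tents around the centers [a k] have height 1 and radius [1 / M]. Once
[1 / M] bounds the distances between the centers from below, each tent vanishes
at the other centers, so that [bump] interpolates the values [w k]. *)
Definition bump x : C R := \sum_(k | P k) (tent (x - a k))%:C%C * w k.

Hypothesis M_ge0 : 0 <= M.

Lemma tent_bounds z : 0 <= tent z <= 1.
Proof.
rewrite /tent le_max lexx ge_max ler01 /= gerBl.
by rewrite mulr_ge0 // modulus_ge0.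
Qed.

Lemma tent_lipschitz z z' : `|tent z - tent z'| <= M * modulus (z - z').
Proof.
have half u v : tent u - tent v <= M * modulus (u - v).
  rewrite lerBlDr ge_max; apply/andP; split.
    by rewrite addr_ge0 ?mulr_ge0 ?modulus_ge0 //; have /andP[] := tent_bounds v.
  apply: (@le_trans _ _ (M * modulus (u - v) + (1 - M * modulus v))); last first.
    by rewrite lerD2l le_max lexx orbT.
  have := ler_wpM2l M_ge0 (ler_modulus_add v u 0).
  by rewrite !subr0 mulrDr modulus_dist; lra.
rewrite ler_norml; have := half z z'; have := half z' z; rewrite modulus_dist.
by move=> *; apply/andP; split; lra.
Qed.

Hypothesis a_separated :
  forall k l, P k -> P l -> k != l -> 1 <= M * modulus (a k - a l).

Lemma bump_center k : P k -> bump (a k) = w k.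
Proof.
move=> Pk; rewrite /bump (bigD1 k) //= big1 => [|l /andP[Pl lk]].
  by rewrite addr0 subrr /tent modulus0 mulr0 subr0 (max_idPr ler01) mul1r.
have := a_separated Pk Pl; rewrite eq_sym lk => /(_ isT) H.
by rewrite /tent (max_idPl _) ?mul0r // subr_le0.
Qed.

Variable eps : R.
Hypothesis w_small : forall k, P k -> modulus (w k) <= eps.

Lemma modulus_sum_le (F : J -> C R) (d : R) : 0 <= d ->
  (forall k, P k -> modulus (F k) <= d) ->
  modulus (\sum_(k | P k) F k) <= #|J|%:R * d.
Proof.
move=> d0 Fd; rewrite big_mkcond; apply: le_trans (modulus_sum _) _.
rewrite mulr_natl -sumr_const; apply: ler_sum => k _.
by case: ifP => [/Fd //|_]; rewrite modulus0.
Qed.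

Hypothesis eps_ge0 : 0 <= eps.

Lemma bump_bounded x : modulus (bump x) <= #|J|%:R * eps.
Proof.
apply: modulus_sum_le => // k Pk; have /andP[t0 t1] := tent_bounds (x - a k).
rewrite modulusM modulus_real ger0_norm // -[leRHS]mul1r.
by apply: ler_pM => //; [exact: modulus_ge0 | exact: w_small].
Qed.

Lemma bump_lipschitz x y :
  modulus (bump x - bump y) <= #|J|%:R * (M * eps) * modulus (x - y).
Proof.
have d0 := modulus_ge0 (x - y).
rewrite -sumrB -mulrA; apply: modulus_sum_le => [|k Pk].
  by rewrite !mulr_ge0.
rewrite -mulrBl modulusM -rmorphB modulus_real mulrAC.
apply: ler_pM => //; [exact: modulus_ge0 | | exact: w_small].
apply: le_trans (tent_lipschitz _ _) _.
by have -> : x - a k - (y - a k) = x - y by ring.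
Qed.

End Bump.

Lemma finite_upper_bound (R : realType) (J : finType) (F : J -> R) :
  exists2 M : R, 1 <= M & forall j, F j <= M.
Proof.
exists (1 + \sum_j `|F j|) => [|j]; first by rewrite lerDl sumr_ge0.
rewrite (bigD1 j) //=; have := ler_norm (F j).
have : 0 <= \sum_(i | i != j) `|F i| by rewrite sumr_ge0.
by lra.
Qed.

(** * Displacing the lines of an arrangement *)

Section LocalTriviality.
Variables (R : realType) (I : finType).
Implicit Types (m c : I -> C R) (e : rel I).

Definition slope_lines m c : set (C R * C R) :=
  [set p | exists i, p.2 = m i * p.1 + c i].

(** The first coordinate of the intersection of the lines [i] and [k]. *)
Definition node m c i k : C R := (c k - c i) / (m i - m k).

(** Here [e] is the relation of parallelism, prescribed in advance so that it
can be kept fixed in a family. The last condition says that the nodes of [i] with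
[k] and with [l] are distinct; it is written without denominators, to be
polynomial in the parameters. *)
Definition admissible e m c := [/\
  forall i k, e i k -> m i = m k,
  forall i k, ~~ e i k -> m i != m k,
  forall i k, i != k -> e i k -> c i != c k &
  forall i k l, ~~ e i k -> ~~ e i l -> k != l ->
    (c k - c i) * (m i - m l) != (c l - c i) * (m i - m k)].

Lemma admissible_node e m c i k l : admissible e m c ->
  ~~ e i k -> ~~ e i l -> k != l -> node m c i k != node m c i l.
Proof.
move=> [_ mne _ dne] ik il kl; apply: contraNneq (dne i k l ik il kl).
have mik := mne _ _ ik; have mil := mne _ _ il.
by move/eqP; rewrite /node eqr_div ?subr_eq0.
Qed.

Lemma admissible_sym e m c i k : admissible e m c -> ~~ e i k -> ~~ e k i.
Proof. by move=> [mE mne _ _] ik; apply: contra (mne _ _ ik) => /mE ->. Qed.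

Lemma nodeC m c i k : node m c i k = node m c k i.
Proof. by rewrite /node -(opprB (c i)) -(opprB (m k)) invrN mulrNN. Qed.

Lemma nodeP m c i k : m i != m k ->
  m i * node m c i k + c i = m k * node m c i k + c k.
Proof. by move=> ik; rewrite /node; field; rewrite subr_eq0. Qed.

(** A single constant [M] measures how far the arrangement is from a degenerate
one: every nonzero quantity that must stay away from 0 is at least [1 / M]. *)
Record quantified e m c (M : R) := Quantified {
  quant_ge1 : 1 <= M;
  quant_card : #|I|%:R <= M;
  (* The margin 1 keeps the slopes of nearby arrangements below [M]. *)
  quant_slope : forall i, modulus (m i) + 1 <= M;
  quant_slopes : forall i k, ~~ e i k -> 1 <= M * modulus (m i - m k);
  quant_gap : forall i k, i != k -> e i k -> 1 <= M * modulus (c i - c k);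
  quant_node : forall i k l, ~~ e i k -> ~~ e i l -> k != l ->
    1 <= M * modulus (node m c i k - node m c i l)
}.

Lemma admissible_quantified e m c : admissible e m c ->
  exists M, quantified e m c M.
Proof.
move=> adm; have [mE mne cne _] := adm.
have [M1 M1_1 M1P] := finite_upper_bound (fun i => modulus (m i) + 1).
have [M2 M2_1 M2P] := finite_upper_bound
  (fun p : I * I => (modulus (m p.1 - m p.2))^-1).
have [M3 M3_1 M3P] := finite_upper_bound
  (fun p : I * I => (modulus (c p.1 - c p.2))^-1).
have [M4 M4_1 M4P] := finite_upper_bound (fun p : I * I * I =>
  (modulus (node m c p.1.1 p.1.2 - node m c p.1.1 p.2))^-1).
have n0 : 0 <= #|I|%:R :> R by [].
pose M := #|I|%:R + M1 + M2 + M3 + M4.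
have inv (z : C R) : z != 0 -> (modulus z)^-1 <= M -> 1 <= M * modulus z.
  by move=> z0; rewrite -(ler_pdivrMr _ _ (_ : 0 < modulus z)) ?modulus_gt0 // div1r.
exists M; split; rewrite /M.
- by lra.
- by lra.
- by move=> i; have := M1P i; lra.
- move=> i k ik; apply: inv; first by rewrite subr_eq0 mne.
  apply: le_trans (M2P (i, k)) _.
  by rewrite /M; lra.
- move=> i k ik eik; apply: inv; first by rewrite subr_eq0 cne.
  by apply: le_trans (M3P (i, k)) _; rewrite /M; lra.
- move=> i k l ik il kl; apply: inv.
    by rewrite subr_eq0; exact: admissible_node adm ik il kl.
  by apply: le_trans (M4P (i, k, l)) _; rewrite /M; lra.
Qed.

Section Displacement.
Variables (e : rel I) (m c m' c' : I -> C R) (M eps : R).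
Hypotheses (adm : admissible e m c) (adm' : admissible e m' c').
Hypotheses (quant : quantified e m c M) (eps_ge0 : 0 <= eps) (eps_le1 : eps <= 1).
Hypotheses (m_close : forall i, modulus (m' i - m i) <= eps)
  (c_close : forall i, modulus (c' i - c i) <= eps)
  (node_close : forall i k, ~~ e i k ->
     modulus (node m' c' i k - node m c i k) <= eps).

(** The reparametrization [x |-> x + slide i x] carries the nodes of the line [i]
to the corresponding nodes of the new line. *)
Definition slide i : C R -> C R :=
  bump (fun k => ~~ e i k) M (node m c i)
       (fun k => node m' c' i k - node m c i k).

(** What must be added to the point of abscissa [x] of the old line [i] to reach
the point of abscissa [x + slide i x] of the new one. *)
Definition displacement i x : C R * C R :=
  (slide i x, (m' i - m i) * x + m' i * slide i x + (c' i - c i)).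

Let M1 : 1 <= M := quant_ge1 quant.
Let M0 : 0 <= M. Proof. exact: le_trans ler01 M1. Qed.

(* Lets linear arithmetic compare monomials of different degrees in [M]. *)
Let grow (b : R) : 0 <= b -> b <= M * b.
Proof. by move=> b0; rewrite -[leLHS]mul1r ler_wpM2r. Qed.

Lemma slide_node i k : ~~ e i k ->
  slide i (node m c i k) = node m' c' i k - node m c i k.
Proof.
apply: (@bump_center _ _ (fun k => ~~ e i k)) => a b; exact: (quant_node quant).
Qed.

Lemma slide_bounded i x : modulus (slide i x) <= M * eps.
Proof.
apply: (le_trans (@bump_bounded _ _ _ _ _ _ M0 _ (@node_close i) eps_ge0 x)).
by rewrite ler_wpM2r // (quant_card quant).
Qed.

Lemma slide_lipschitz i x y :
  modulus (slide i x - slide i y) <= M * (M * eps) * modulus (x - y).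
Proof.
apply: (le_trans (@bump_lipschitz _ _ _ _ _ _ M0 _ (@node_close i) eps_ge0 x y)).
rewrite ler_wpM2r ?modulus_ge0 // ler_wpM2r ?mulr_ge0 //.
exact: (quant_card quant).
Qed.

Let slope'_le i : modulus (m' i) <= M.
Proof.
have := modulusD (m i) (m' i - m i).
have -> : m i + (m' i - m i) = m' i by ring.
by have h1 := m_close i; have h2 := quant_slope quant i; move: eps_le1; lra.
Qed.

Let slope_le i : modulus (m i) <= M.
Proof. by have := quant_slope quant i; lra. Qed.

Lemma displacement_lipschitz i x y :
  dist (displacement i x) (displacement i y) <= 3 * M ^+ 3 * eps * modulus (x - y).
Proof.
have sl := slide_lipschitz i x y; rewrite /dist /=.
set d := modulus (x - y) in sl *; have d0 : 0 <= d by exact: modulus_ge0.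
have -> : (m' i - m i) * x + m' i * slide i x + (c' i - c i) -
    ((m' i - m i) * y + m' i * slide i y + (c' i - c i)) =
    (m' i - m i) * (x - y) + m' i * (slide i x - slide i y) by ring.
have h1 : modulus ((m' i - m i) * (x - y)) <= eps * d.
  by rewrite modulusM ler_wpM2r.
have h2 : modulus (m' i * (slide i x - slide i y)) <= M * (M * (M * eps) * d).
  by rewrite modulusM ler_pM ?modulus_ge0.
have := modulusD ((m' i - m i) * (x - y)) (m' i * (slide i x - slide i y)).
have b0 : 0 <= eps * d by rewrite mulr_ge0.
have g1 := grow b0; have g2 := grow (mulr_ge0 M0 b0).
have g3 := grow (mulr_ge0 M0 (mulr_ge0 M0 b0)).
by lra.
Qed.

(** Both displacements move the old node to the new one. *)
Lemma displacement_node i k : ~~ e i k ->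
  displacement i (node m c i k) = displacement k (node m c i k).
Proof.
move=> ik; have ki := admissible_sym adm ik.
rewrite /displacement slide_node // [node m c i k]nodeC slide_node //.
rewrite -[node m c k i]nodeC [node m' c' k i]nodeC; congr pair.
have [_ mne _ _] := adm; have [_ mne' _ _] := adm'.
have E := nodeP c (mne _ _ ik); have E' := nodeP c' (mne' _ _ ik).
set x := node m c i k in E *; set x' := node m' c' i k in E' *.
have -> : (m' i - m i) * x + m' i * (x' - x) + (c' i - c i) =
  (m' i * x' + c' i) - (m i * x + c i) by ring.
by rewrite E E'; ring.
Qed.

(** The case [p = q] shows that the displacements define a map on the union of
the lines. For intersecting lines the estimate passes through the node [x]: the
difference of the slopes bounds the distances of [p] and [q] to it by a multiple
of [dist p q]. For parallel lines [dist p q] is bounded below, and so dominates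
the bounded terms [slide] and [c' - c]; the unbounded term [(m' - m) * x] is the
same function for both lines. *)
Lemma displacement_lipschitz_on_lines i k p q :
  p.2 = m i * p.1 + c i -> q.2 = m k * q.1 + c k ->
  dist (displacement i p.1) (displacement k q.1) <= 7 * M ^+ 5 * eps * dist p q.
Proof.
move=> pi qk; set D := dist p q.
have D0 : 0 <= D by exact: dist_ge0.
have b0 : 0 <= eps * D by rewrite mulr_ge0.
have g1 := grow b0; have g2 := grow (mulr_ge0 M0 b0).
have g3 := grow (mulr_ge0 M0 (mulr_ge0 M0 b0)).
have g4 := grow (mulr_ge0 M0 (mulr_ge0 M0 (mulr_ge0 M0 b0))).
have g5 := grow (mulr_ge0 M0 (mulr_ge0 M0 (mulr_ge0 M0 (mulr_ge0 M0 b0)))).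
have d1 : modulus (p.1 - q.1) <= D by rewrite /D /dist lerDl modulus_ge0.
have vertical j : modulus (p.2 - q.2) + modulus (m j * (p.1 - q.1)) <= M * D.
  rewrite modulusM /D /dist mulrDr addrC lerD //.
    by rewrite ler_wpM2r // modulus_ge0.
  by rewrite grow // modulus_ge0.
have [->|ik] := eqVneq i k.
  apply: le_trans (displacement_lipschitz _ _ _) _.
  have : 3 * M ^+ 3 * eps * modulus (p.1 - q.1) <= 3 * M ^+ 3 * eps * D.
    by rewrite ler_wpM2l // !mulr_ge0 // exprn_ge0.
  by lra.
case: (boolP (e i k)) => eik.
  have [mE _ _ _] := adm; have [mE' _ _ _] := adm'.
  have gap : 1 <= M * (M * D).
    apply: le_trans (quant_gap quant ik eik) _; apply: ler_wpM2l => //.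
    apply: le_trans (vertical k); apply: le_trans (modulusB _ _).
    rewrite pi qk (mE _ _ eik) (_ : _ - _ - _ = c i - c k) //; ring.
  rewrite /dist /= (mE _ _ eik) (mE' _ _ eik).
  have s1 := slide_bounded i p.1; have s2 := slide_bounded k q.1.
  set s := slide i p.1 in s1 *; set t := slide k q.1 in s2 *.
  have h0 := modulusB s t.
  have -> : (m' k - m k) * p.1 + m' k * s + (c' i - c i) -
    ((m' k - m k) * q.1 + m' k * t + (c' k - c k)) =
    (m' k - m k) * (p.1 - q.1) + m' k * (s - t) + ((c' i - c i) - (c' k - c k)) by ring.
  set u := (m' k - m k) * (p.1 - q.1); set v := m' k * (s - t).
  have h1 : modulus u <= eps * D by rewrite modulusM ler_pM ?modulus_ge0.
  have h2 : modulus v <= M * (2 * (M * eps)).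
    by rewrite modulusM ler_pM ?modulus_ge0 //; lra.
  have h3 := modulusB (c' i - c i) (c' k - c k).
  have h4 := modulusD (u + v) ((c' i - c i) - (c' k - c k)).
  have h5 := modulusD u v.
  have h6 := c_close i; have h7 := c_close k.
  have h8 : eps <= M * (M * (eps * D)).
    have -> : M * (M * (eps * D)) = eps * (M * (M * D)) by ring.
    by rewrite -[leLHS]mulr1 ler_wpM2l.
  have h9 := ler_wpM2l M0 h8.
  have h10 := ler_wpM2l M0 h9.
  by lra.
have [_ mne _ _] := adm; have E := nodeP c (mne _ _ eik).
have [x xE] : exists x, x = node m c i k by exists (node m c i k).
have Ec : c i = m k * x + c k - m i * x by rewrite xE -E; ring.
have reach (z : C R) j : (m i - m k) * z = (p.2 - q.2) - m j * (p.1 - q.1) ->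
    modulus z <= M * (M * D).
  move=> zE; have : modulus ((m i - m k) * z) <= M * D.
    by rewrite zE; apply: le_trans (modulusB _ _) (vertical j).
  rewrite modulusM => H.
  have := ler_wpM2r (modulus_ge0 z) (quant_slopes quant eik); rewrite mul1r => H2.
  apply: le_trans H2 _; rewrite -mulrA; exact: ler_wpM2l.
have r1 : modulus (p.1 - x) <= M * (M * D).
  by apply: (reach _ k); rewrite pi qk Ec; ring.
have r2 : modulus (x - q.1) <= M * (M * D).
  rewrite modulus_dist; apply: (reach _ i); rewrite pi qk Ec; ring.
apply: le_trans (dist_triangle (displacement i x) _ _) _.
rewrite [in X in _ + X]xE displacement_node // -xE.
have l1 := displacement_lipschitz i p.1 x; have l2 := displacement_lipschitz k x q.1.
have K0 : 0 <= 3 * M ^+ 3 * eps by rewrite !mulr_ge0 // exprn_ge0.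
have l3 := ler_wpM2l K0 r1; have l4 := ler_wpM2l K0 r2.
by lra.
Qed.

End Displacement.
End LocalTriviality.

(** * Local triviality of admissible families *)

Section AmbientEquivalence.
Variable R : realType.
Implicit Types X Y Z : set (C R * C R).

Definition ambient_equivalent X Y :=
  exists2 Phi : C R * C R -> C R * C R, homeomorphism Phi & Phi @` X = Y.

Lemma ambient_equivalent_refl X : ambient_equivalent X X.
Proof.
exists id; last by rewrite image_id.
by split; [move=> p | exists id; split => // p]; exact: cvg_id.
Qed.

Lemma ambient_equivalent_sym X Y : ambient_equivalent X Y -> ambient_equivalent Y X.
Proof.
move=> [Phi [cPhi [g [cg PhiK gK]]] <-]; exists g; first by split=> //; exists Phi.
by rewrite image_comp (_ : g \o Phi = id) ?image_id //; apply/funext.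
Qed.

Lemma ambient_equivalent_trans Y X Z :
  ambient_equivalent X Y -> ambient_equivalent Y Z -> ambient_equivalent X Z.
Proof.
move=> [F [cF [f [cf FK fK]]] <-] [G [cG [g [cg GK gK]]] <-].
exists (G \o F); last by rewrite image_comp.
split; first by move=> p; apply: continuous_comp; [exact: cF | exact: cG].
exists (f \o g); split.
- by move=> p; apply: continuous_comp; [exact: cg | exact: cf].
- by move=> p /=; rewrite GK FK.
- by move=> p /=; rewrite fK gK.
Qed.

End AmbientEquivalence.

Section LocalTrivialityTheorem.
Variables (R : realType) (I : finType) (e : rel I) (m c : I -> C R).

(** The displacements of the lines glue to a Lipschitz map on their union, with
constant [7 * M ^ 5 * eps]. The map [Phi] sends each line into the new one; it
reaches every point because [x |-> x + slide i x] is itself a Lipschitz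
perturbation of the identity of the complex line.

That the nodes move little is a separate hypothesis; it holds when the
parameters are close, by continuity along the family considered. *)
Lemma local_triviality : admissible e m c ->
  exists2 eps : R, 0 < eps & forall m' c', admissible e m' c' ->
    (forall i, modulus (m' i - m i) <= eps) ->
    (forall i, modulus (c' i - c i) <= eps) ->
    (forall i k, ~~ e i k -> modulus (node m' c' i k - node m c i k) <= eps) ->
    ambient_equivalent (slope_lines m c) (slope_lines m' c').
Proof.
move=> adm; have [M quant] := admissible_quantified adm.
have M1 := quant_ge1 quant; have M0 : 0 < M by exact: lt_le_trans ltr01 M1.
have M5 : 1 <= M ^+ 5 by rewrite exprn_ege1.
(* With this value of [eps] the constant [7 * M ^ 5 * eps] is 8^-1. *)
have eps0 : 0 < (56 * M ^+ 5)^-1 by rewrite invr_gt0; lra.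
have eps1 : (56 * M ^+ 5)^-1 <= 1 by rewrite invf_le1; lra.
have small : 7 * M ^+ 5 * (56 * M ^+ 5)^-1 <= 8^-1.
  by rewrite le_eqVlt; apply/orP; left; apply/eqP; field; rewrite gt_eqF //; lra.
exists (56 * M ^+ 5)^-1 => //; set eps := _^-1 in eps0 eps1 small *.
move=> m' c' adm' mm' cc' nn'.
have DL := displacement_lipschitz_on_lines adm adm' quant (ltW eps0) eps1 mm' cc' nn'.
pose D := displacement e m c m' c' M.
pose h p := if pselect (exists i, p.2 = m i * p.1 + c i) is left H
            then D (projT1 (cid H)) p.1 else 0.
have hE p i : p.2 = m i * p.1 + c i -> h p = D i p.1.
  rewrite /h; case: pselect => [H pi|H pi]; last by case: H; exists i.
  apply: dist_le0_eq; apply: le_trans (DL _ _ _ _ (projT2 (cid H)) pi) _.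
  by rewrite dist_self mulr0.
have hL : lipschitz_on_set (slope_lines m c) 8^-1 h.
  move=> p q [i pi] [k qk]; rewrite (hE p i pi) (hE q k qk).
  apply: le_trans (DL i k p q pi qk) _.
  by apply: ler_wpM2r => //; exact: dist_ge0.
have [Phi homeo PhiE] := ambient_homeomorphism hL.
exists Phi => //; apply/seteqP; split.
  move=> _ [p [i pi] <-]; rewrite PhiE; last by exists i.
  by exists i; rewrite (hE p i pi) /= pi; ring.
move=> q [i qi].
pose s := slide e m c m' c' M i.
(* The plane result, applied to a perturbation of the first coordinate only. *)
have [p pq] : exists p : C R * C R, p + (s p.1, 0) = (q.1, 0).
  apply: (@perturbation_surjective _ (fun p => (s p.1, 0))) => a b _ _.
  rewrite /dist /= subrr modulus0 addr0.
  apply: le_trans (slide_lipschitz quant (ltW eps0) nn' i a.1 b.1) _.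
  have M2 : M * (M * eps) <= 2^-1.
    have : M ^+ 2 * eps <= M ^+ 5 * eps.
      by rewrite ler_wpM2r ?(ltW eps0) // ler_weXn2l.
    by rewrite expr2 -mulrA; lra.
  apply: ler_pM => //; last by rewrite lerDl modulus_ge0.
  - by rewrite !mulr_ge0 // ltW.
  - exact: modulus_ge0.
have {pq}xq : p.1 + s p.1 = q.1 by have := congr1 fst pq.
exists (p.1, m i * p.1 + c i); first by exists i.
rewrite PhiE; last by exists i.
rewrite (hE _ i) //.
have -> : D i p.1 = (s p.1, (m' i - m i) * p.1 + m' i * s p.1 + (c' i - c i)) by [].
move: (s p.1) xq => sp xq.
case: q xq qi => q1 q2 /= <- ->; congr pair => /=; ring.
Qed.

End LocalTrivialityTheorem.

(** * A path of admissible parameters *)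

Section Path.
Variable R : realType.
Implicit Types (s t : R) (z : C R).

Definition arc (lambda s : R) : C R :=
  s%:C%C + 'i%C * (lambda * (s * (1 - s)))%:C%C.

Lemma arcE lambda s : arc lambda s = Complex s (lambda * (s * (1 - s))).
Proof.
rewrite /arc; apply/eqP; rewrite eq_complex /=.
by apply/andP; split; apply/eqP; ring.
Qed.

Lemma arc0 lambda : arc lambda 0 = 0.
Proof. by rewrite arcE mul0r mulr0. Qed.

Lemma arc1 lambda : arc lambda 1 = 1.
Proof. by rewrite arcE subrr !mulr0. Qed.

Lemma real_complex_continuous : continuous (fun s : R => s%:C%C : C R).
Proof.
move=> s; apply/cvgrPdist_lt => eps eps0.
have epsE : eps = (Re eps)%:C%C by rewrite -[LHS]RRe_real // gtr0_real.
have r0 : 0 < Re eps by move: eps0; rewrite {1}epsE ltcR.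
near=> t; rewrite epsE normE ltcR -rmorphB modulus_real.
by near: t; apply: cvgr_dist_lt r0; exact: cvg_id.
Unshelve. all: by end_near.
Qed.

Lemma arc_continuous lambda : continuous (arc lambda).
Proof.
move=> s; apply: cvgD; first exact: real_complex_continuous.
apply: cvgM; first exact: cvg_cst.
apply: (@continuous_comp _ _ _ (fun s => lambda * (s * (1 - s)))).
  apply: cvgM; first exact: cvg_cst.
  by apply: cvgM; [exact: cvg_id | apply: cvgB; [exact: cvg_cst | exact: cvg_id]].
exact: real_complex_continuous.
Qed.

(** A root [z] on the arc has [Re z = s], different from 0 and 1, and determines
[lambda] as [Im z / (Re z * (1 - Re z))]; it is enough to exceed all these
values. The arc misses the roots for every real [s], so that the parameter can
range over the whole connected line. *)
Lemma arc_avoids_roots (Q : {poly C R}) : Q.[0] != 0 -> Q.[1] != 0 ->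
  exists lambda, forall s, Q.[arc lambda s] != 0.
Proof.
move=> Q0 Q1; have [r Qr] := closed_field_poly_normal Q.
have lead0 : lead_coef Q != 0.
  by apply: contraNneq Q0 => /eqP; rewrite lead_coef_eq0 => /eqP ->; rewrite horner0.
pose slope (z : C R) := `|Im z / (Re z * (1 - Re z))|.
exists (1 + \sum_(z <- r) slope z) => s; apply/negP => /eqP.
set lambda := 1 + _.
have [->|s0] := eqVneq s 0.
  by rewrite arc0 => /eqP; rewrite (negbTE Q0).
have [->|s1] := eqVneq s 1.
  by rewrite arc1 => /eqP; rewrite (negbTE Q1).
rewrite {1}Qr hornerZ => /eqP; rewrite mulf_eq0 (negbTE lead0) /=.
rewrite -/(root _ _) root_prod_XsubC => zr.
have : slope (arc lambda s) <= \sum_(z <- r) slope z.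
  by rewrite (big_rem _ zr) lerDl; apply: sumr_ge0 => w _; exact: normr_ge0.
rewrite /slope arcE /= mulfK; last by rewrite mulf_neq0 // subr_eq0 eq_sym.
by have := ler_norm lambda; rewrite /lambda; lra.
Qed.

(** The class of [X s] is clopen in the connected real line. *)
Lemma locally_constant_equivalent (X : R -> set (C R * C R)) :
  (forall s, \forall t \near s, ambient_equivalent (X s) (X t)) ->
  forall s t, ambient_equivalent (X s) (X t).
Proof.
move=> Xloc s t.
pose B := [set u | ambient_equivalent (X s) (X u)].
suff : B = setT by move=> BT; have : B t by rewrite BT.
have connR : connected [set: R] by apply/connected_intervalP.
apply: connR.
- by exists s; exact: ambient_equivalent_refl.
- exists B; last by rewrite setTI.
  rewrite openE => u Bu; rewrite /interior.
  apply: filterS (Xloc u) => v; exact: ambient_equivalent_trans.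
- exists B; last by rewrite setTI.
  rewrite -openC openE => u Bu; apply: filterS (Xloc u) => v uv Bv; apply: Bu.
  exact: ambient_equivalent_trans Bv (ambient_equivalent_sym uv).
Qed.

Lemma continuous_modulus_near (F : R -> C R) s (eps : R) : 0 < eps ->
  {for s, continuous F} -> \forall t \near s, modulus (F t - F s) <= eps.
Proof.
move=> eps0 cF; have e0 : 0 < (eps%:C%C : C R) by rewrite ltcR.
near=> t; rewrite modulus_dist -lecR -normE ltW //.
by near: t; apply: cvgr_dist_lt e0; exact: cF.
Unshelve. all: by end_near.
Qed.

End Path.

Section Deformation.
Variables (R : realType) (I : finType) (e : rel I).
Implicit Types (m c a b : I -> C R) (t : C R).

Definition segment_family a b t i : C R := a i + t * (b i - a i).

Definition segment_poly a b i : {poly C R} := (a i)%:P + 'X * (b i - a i)%:P.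

Lemma segment_polyE a b i t : (segment_poly a b i).[t] = segment_family a b t i.
Proof. by rewrite /segment_poly !hornerE. Qed.

Lemma segment_family0 a b : segment_family a b 0 = a.
Proof. by apply/funext => i; rewrite /segment_family mul0r addr0. Qed.

Lemma segment_family1 a b : segment_family a b 1 = b.
Proof. by apply/funext => i; rewrite /segment_family mul1r addrC subrK. Qed.

(** Parallelism is preserved along the segment because both ends have the same
relation [e]; each of the other conditions is that a polynomial in [t] does not
vanish, and [Q] is the product of these polynomials. *)
Lemma admissible_polynomial m0 c0 m1 c1 :
  admissible e m0 c0 -> admissible e m1 c1 ->
  exists Q : {poly C R}, forall t,
    Q.[t] != 0 <-> admissible e (segment_family m0 m1 t) (segment_family c0 c1 t).
Proof.
move=> [mE0 _ _ _] [mE1 _ _ _].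
pose mp := segment_poly m0 m1; pose cp := segment_poly c0 c1.
pose Q1 := \prod_(p : I * I | ~~ e p.1 p.2) (mp p.1 - mp p.2).
pose Q2 := \prod_(p : I * I | (p.1 != p.2) && e p.1 p.2) (cp p.1 - cp p.2).
pose Q3 := \prod_(p : I * I * I | [&& ~~ e p.1.1 p.1.2, ~~ e p.1.1 p.2 & p.1.2 != p.2])
  ((cp p.1.2 - cp p.1.1) * (mp p.1.1 - mp p.2) -
   (cp p.2 - cp p.1.1) * (mp p.1.1 - mp p.1.2)).
exists (Q1 * Q2 * Q3) => t.
have mpE i : (mp i).[t] = segment_family m0 m1 t i by exact: segment_polyE.
have cpE i : (cp i).[t] = segment_family c0 c1 t i by exact: segment_polyE.
rewrite !hornerM !mulf_eq0 !negb_or /Q1 /Q2 /Q3 !horner_prod.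
split.
  move=> /andP[/andP[/prodf_neq0 H1 /prodf_neq0 H2] /prodf_neq0 H3]; split.
  - by move=> i k ik; rewrite /segment_family (mE0 _ _ ik) (mE1 _ _ ik).
  - by move=> i k ik; have := H1 (i, k) ik; rewrite !hornerE ?mpE ?cpE subr_eq0.
  - move=> i k ik eik; have := H2 (i, k); rewrite /= ik eik => /(_ isT).
    by rewrite !hornerE ?mpE ?cpE subr_eq0.
  - move=> i k l ik il kl; have := H3 (i, k, l); rewrite /= ik il kl => /(_ isT).
    by rewrite !hornerE ?mpE ?cpE subr_eq0.
move=> [_ mne cne dne]; apply/andP; split; first apply/andP; first split.
- by apply/prodf_neq0 => -[i k] /= ik; rewrite !hornerE ?mpE ?cpE subr_eq0 mne.
- by apply/prodf_neq0 => -[i k] /= /andP[ik eik];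
    rewrite !hornerE ?mpE ?cpE subr_eq0 cne.
- by apply/prodf_neq0 => -[[i k] l] /= /and3P[ik il kl];
    rewrite !hornerE ?mpE ?cpE subr_eq0 dne.
Qed.

Lemma slope_lines_equivalent m0 c0 m1 c1 :
  admissible e m0 c0 -> admissible e m1 c1 ->
  ambient_equivalent (slope_lines m0 c0) (slope_lines m1 c1).
Proof.
move=> adm0 adm1; have [Q QP] := admissible_polynomial adm0 adm1.
have Q0 : Q.[0] != 0 by apply/QP; rewrite !segment_family0.
have Q1 : Q.[1] != 0 by apply/QP; rewrite !segment_family1.
have [lambda avoid] := arc_avoids_roots Q0 Q1.
pose mt s := segment_family m0 m1 (arc lambda s).
pose ct s := segment_family c0 c1 (arc lambda s).
have -> : m0 = mt 0 by rewrite /mt arc0 segment_family0.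
have -> : c0 = ct 0 by rewrite /ct arc0 segment_family0.
have -> : m1 = mt 1 by rewrite /mt arc1 segment_family1.
have -> : c1 = ct 1 by rewrite /ct arc1 segment_family1.
apply: (@locally_constant_equivalent R (fun s => slope_lines (mt s) (ct s))) => s.
have adm u : admissible e (mt u) (ct u) by apply/QP.
have [eps eps0 epsP] := local_triviality (adm s).
have seg_cts a b i : continuous (fun s => segment_family a b (arc lambda s) i).
  move=> u; apply: cvgD; first exact: cvg_cst.
  by apply: cvgM; [exact: arc_continuous | exact: cvg_cst].
have mt_cts i : continuous (fun s => mt s i) by exact: seg_cts.
have ct_cts i : continuous (fun s => ct s i) by exact: seg_cts.
have node_cts i k : ~~ e i k -> continuous (fun s => node (mt s) (ct s) i k).
  move=> ik u; apply: cvgM; first by apply: cvgB; exact: ct_cts.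
  apply: cvgV; last by apply: cvgB; exact: mt_cts.
  by have [_ mne _ _] := adm u; rewrite subr_eq0 mne.
have near_m : \forall t \near s, forall i, modulus (mt t i - mt s i) <= eps.
  by apply: (@filter_forall _ _
      (fun i u => modulus (mt u i - mt s i) <= eps) _ (nbhs_filter s)) => i;
    exact: (continuous_modulus_near eps0 (mt_cts i s)).
have near_c : \forall t \near s, forall i, modulus (ct t i - ct s i) <= eps.
  by apply: (@filter_forall _ _
      (fun i u => modulus (ct u i - ct s i) <= eps) _ (nbhs_filter s)) => i;
    exact: (continuous_modulus_near eps0 (ct_cts i s)).
have near_n : \forall t \near s, forall p : I * I, ~~ e p.1 p.2 ->
    modulus (node (mt t) (ct t) p.1 p.2 - node (mt s) (ct s) p.1 p.2) <= eps.
  apply: (@filter_forall _ _ (fun (p : I * I) u => ~~ e p.1 p.2 ->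
    modulus (node (mt u) (ct u) p.1 p.2 - node (mt s) (ct s) p.1 p.2) <= eps)
    _ (nbhs_filter s)).
  move=> -[i k] /=; case: (boolP (e i k)) => ik.
    by apply: nearW.
  have := continuous_modulus_near eps0 (node_cts i k ik s).
  by apply: filterS => t H _.
near=> t; apply: epsP => //.
- by near: t.
- by near: t.
- move=> i k ik; have : forall p : I * I, ~~ e p.1 p.2 ->
    modulus (node (mt t) (ct t) p.1 p.2 - node (mt s) (ct s) p.1 p.2) <= eps by near: t.
  by move=> /(_ (i, k)); exact.
Unshelve. all: by end_near.
Qed.

End Deformation.

(** * Matching the lines of arrangements with the same combinatorics *)

Lemma perm_eq_map_lift (T T' : eqType) (f : T -> T') (t : seq T') (u : seq T) :
  perm_eq t (map f u) -> exists2 u', perm_eq u' u & t = map f u'.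
Proof.
elim: t u => [|x t IH] u.
  rewrite perm_sym => /perm_nilP uE; exists [::] => //.
  by case: u uE.
move=> xtu; have /mapP[y yu xE] : x \in map f u by rewrite -(perm_mem xtu) mem_head.
have yrem := perm_to_rem yu.
have [u' u'P tE] : exists2 u', perm_eq u' (rem y u) & t = map f u'.
  apply: IH; rewrite -(perm_cons x) {2}xE; apply: perm_trans xtu _.
  exact: perm_map yrem.
exists (y :: u'); last by rewrite /= xE tE.
by rewrite perm_sym; apply: perm_trans yrem _; rewrite perm_cons perm_sym.
Qed.

(** Equality of the multiplicities as multisets pairs the values of [s] with
those of [s'] in such a way that paired values occur equally often. *)
Lemma tally_matching (T : eqType) (s s' : seq T) :
  perm_eq [seq count_mem x s | x <- undup s] [seq count_mem x s' | x <- undup s'] ->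
  exists2 g : T -> T, {in s &, injective g} & perm_eq (map g s) s'.
Proof.
move=> /perm_eq_map_lift[D' D'perm tallyE].
have sizeD : size (undup s) = size D' by have := congr1 size tallyE; rewrite !size_map.
have uD' : uniq D' by rewrite (perm_uniq D'perm) undup_uniq.
(* [x] is only a default: the index is in range when [x] is in [s]. *)
pose g x := nth x D' (index x (undup s)).
have idx x : x \in s -> (index x (undup s) < size D')%N.
  by move=> xs; rewrite -sizeD index_mem mem_undup.
have gD x y : x \in s -> g x = nth y D' (index x (undup s)).
  by move=> xs; apply: set_nth_default; exact: idx.
have gtally x : x \in s -> count_mem x s = count_mem (g x) s'.
  move=> xs; have := congr1 (fun r => nth 0%N r (index x (undup s))) tallyE.
  by rewrite (nth_map x) ?sizeD ?idx // (nth_map x) ?idx // nth_index ?mem_undup.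
have ginj : {in s &, injective g}.
  move=> x y xs ys; rewrite (gD y x ys) /g => /eqP; rewrite nth_uniq ?idx // => /eqP E.
  have := congr1 (nth x (undup s)) E.
  by rewrite !nth_index ?mem_undup.
exists g => //.
have gcount x : x \in s -> count_mem (g x) (map g s) = count_mem (g x) s'.
  move=> xs; rewrite -gtally // count_map; apply: eq_in_count => y ys /=.
  by apply/eqP/eqP => [/ginj ->|->].
apply/allP => y; rewrite mem_cat => /orP[/mapP[x xs ->]|ys']; first exact/eqP/gcount.
have yD' : y \in D' by rewrite (perm_mem D'perm) mem_undup.
pose x := nth y (undup s) (index y D').
have yidx : (index y D' < size (undup s))%N by rewrite sizeD index_mem.
have xs : x \in s by rewrite -mem_undup mem_nth.
have -> : y = g x by rewrite (gD x y) // /x index_uniq ?undup_uniq // nth_index.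
exact/eqP/gcount.
Qed.

Lemma perm_eq_image_matching (T : eqType) (n n' : nat)
    (a : 'I_n -> T) (b : 'I_n' -> T) :
  perm_eq [seq a i | i : 'I_n] [seq b i | i : 'I_n'] ->
  exists2 sigma : 'I_n -> 'I_n', bijective sigma & forall i, a i = b (sigma i).
Proof.
move=> ab; have := perm_size ab; rewrite !size_image !card_ord => nn'.
case: n' / nn' b ab => b.
have -> : [seq b i | i : 'I_n] = [tuple b i | i < n] :> seq T by [].
move=> /tuple_permP[sigma E]; exists (sigma : 'I_n -> 'I_n).
  exact: injF_bij (@perm_inj _ sigma).
move=> i; have {}E : [tuple a i | i < n] =
    [tuple tnth [tuple b i | i < n] (sigma i) | i < n].
  exact: val_inj.
by have := congr1 (fun t => tnth t i) E; rewrite !tnth_mktuple.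
Qed.

Lemma same_combinatorics_matching (R : realType) (A0 A1 : arrangement R) :
  same_combinatorics A0 A1 ->
  exists2 sigma : 'I_(nlines A0) -> 'I_(nlines A1), bijective sigma &
    forall i k, (direction (lines A0 i) == direction (lines A0 k)) =
      (direction (lines A1 (sigma i)) == direction (lines A1 (sigma k))).
Proof.
pose dirs (A : arrangement R) := [seq direction (lines A i) | i : 'I_(nlines A)].
have tally A : combinatorics A = [seq count_mem x (dirs A) | x <- undup (dirs A)].
  apply: eq_map => delta; rewrite /dirs count_map cardE size_filter.
  by rewrite enumT; apply: eq_count.
rewrite /same_combinatorics !tally => /tally_matching[g ginj].
rewrite /dirs -map_comp => /perm_eq_image_matching[sigma sbij sE].
exists sigma => // i k; rewrite -!sE /=; apply/eqP/eqP => [->//|].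
by apply: ginj; exact: codom_f.
Qed.

(** * Reduction to lines given by their slopes *)

Section Lines.
Variable R : realType.
Implicit Types (l : line R) (p : C R * C R).

Variable mu : C R.

Definition shear p : C R * C R := (p.1 + mu * p.2, p.2).
Definition unshear p : C R * C R := (p.1 - mu * p.2, p.2).

Lemma shearK : cancel shear unshear.
Proof. by move=> [x y]; rewrite /unshear /shear /= addrK. Qed.

Lemma unshearK : cancel unshear shear.
Proof. by move=> [x y]; rewrite /unshear /shear /= subrK. Qed.

Lemma shear_homeomorphism : homeomorphism shear.
Proof.
have k0 := modulus_ge0 mu.
have two (p q : C R * C R) (nu : C R) : modulus nu = modulus mu ->
    dist (p.1 + nu * p.2, p.2) (q.1 + nu * q.2, q.2) <= (1 + modulus mu) * dist p q.
  move=> E; rewrite /dist /=.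
  have -> : p.1 + nu * p.2 - (q.1 + nu * q.2) = p.1 - q.1 + nu * (p.2 - q.2) by ring.
  have := modulusD (p.1 - q.1) (nu * (p.2 - q.2)); rewrite modulusM E.
  have := mulr_ge0 k0 (modulus_ge0 (p.1 - q.1)).
  by lra.
split.
  by apply: (@lipschitz_continuous _ (1 + modulus mu)) => p q _ _; exact: two.
exists unshear; split; [|exact: shearK | exact: unshearK].
apply: (@lipschitz_continuous _ (1 + modulus mu)) => p q _ _.
by have := two p q (- mu) (modulusN _); rewrite !mulNr.
Qed.

(** In the coordinates [(x + mu y, y)] the line [l] has equation
[la X + (lb - mu la) Y + lc = 0]; it is a graph over the first axis when the
coefficient of [Y] is nonzero. *)
Definition steepness l : C R := lb l - mu * la l.
Definition slope l : C R := - la l / steepness l.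
Definition intercept l : C R := - lc l / steepness l.

Lemma shear_points l p : steepness l != 0 ->
  points l p <-> (shear p).2 = slope l * (shear p).1 + intercept l.
Proof.
move=> s0; rewrite /points /= /slope /intercept; split.
  move=> E; rewrite /shear /=; have -> : lc l = - (la l * p.1 + lb l * p.2).
    by apply/eqP; rewrite -addr_eq0 addrC E.
  by rewrite /steepness in s0 *; field.
move=> /= E.
have -> : la l * p.1 + lb l * p.2 + lc l = steepness l *
    (p.2 - (- la l / steepness l * (p.1 + mu * p.2) + - lc l / steepness l)).
  by rewrite /steepness in s0 *; field.
by rewrite -E subrr mulr0.
Qed.

Lemma slope_eq l l' : steepness l != 0 -> steepness l' != 0 ->
  (slope l == slope l') = (direction l == direction l').
Proof.
move=> s0 s0'.
have sub l1 l2 : steepness l1 != 0 -> steepness l2 != 0 -> slope l1 = slope l2 ->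
    (direction l1 <= direction l2)%VS.
  move=> s1 s2 E; rewrite /direction -memvE; apply/vlineP.
  exists (steepness l1 / steepness l2).
  have Ea : la l1 = steepness l1 / steepness l2 * la l2.
    have -> : la l1 = - slope l1 * steepness l1 by rewrite /slope; field.
    by rewrite E /slope; field.
  have lbE l0 : lb l0 = steepness l0 + mu * la l0 by rewrite /steepness; ring.
  have Eb : lb l1 = steepness l1 / steepness l2 * lb l2.
    by rewrite (lbE l1) (lbE l2) Ea; field.
  by rewrite {1}Ea {1}Eb.
apply/eqP/eqP => [E|E].
  by apply/eqP; rewrite eqEsubv !sub.
have : (la l, lb l) \in direction l' by rewrite -E memv_line.
move=> /vlineP[k [Ea Eb]].
have {}Ea : la l = k * la l' := Ea.
have {}Eb : lb l = k * lb l' := Eb.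
have Sk : steepness l = k * steepness l'.
  by rewrite /steepness Ea Eb; ring.
have k0 : k != 0 by apply: contraNneq s0 => k0; rewrite Sk k0 mul0r.
by rewrite /slope Sk Ea /=; field; rewrite k0 s0'.
Qed.

(** If two nodes of [i] coincided, their common point would lie on three
lines. *)
Lemma admissible_lines (I : finType) (e : rel I) (L : I -> line R) :
  (forall i, steepness (L i) != 0) ->
  injective (fun i => points (L i)) ->
  (forall i j k, uniq [:: i; j; k] ->
     points (L i) `&` points (L j) `&` points (L k) = set0) ->
  (forall i k, e i k = (direction (L i) == direction (L k))) ->
  admissible e (fun i => slope (L i)) (fun i => intercept (L i)).
Proof.
move=> st0 Linj L3 eE.
have sE i k : e i k = (slope (L i) == slope (L k)) by rewrite eE slope_eq.
have ee i : e i i by rewrite eE.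
split.
- by move=> i k; rewrite sE => /eqP.
- by move=> i k; rewrite sE.
- move=> i k ik; rewrite sE => /eqP mik; apply: contraNneq ik => cik.
  apply/eqP/Linj/seteqP; split=> p; rewrite !shear_points //.
    by rewrite mik cik.
  by rewrite mik cik.
move=> i k l ik il kl; apply/negP => /eqP E.
have mik : slope (L i) != slope (L k) by rewrite -sE.
have mil : slope (L i) != slope (L l) by rewrite -sE.
pose m j := slope (L j); pose c j := intercept (L j).
have nE : node m c i k = node m c i l.
  by apply/eqP; rewrite /node eqr_div ?subr_eq0 //; apply/eqP.
pose x := node m c i k; pose p := unshear (x, m i * x + c i).
have ikl : uniq [:: i; k; l].
  rewrite /= !inE negb_or kl !andbT; apply/andP; split.
    by apply: contraNneq ik => <-.
  by apply: contraNneq il => <-.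
suff : set0 p by [].
rewrite -(L3 _ _ _ ikl); split; first split; apply/shear_points => //;
  rewrite unshearK //=.
  exact: (nodeP c mik).
by rewrite /x nE; exact: (nodeP c mil).
Qed.

(** The lines are renumbered by [tau], so that two arrangements can be indexed by
the same set along a matching. *)
Lemma support_shear (n : nat) (A : arrangement R) (tau : 'I_n -> 'I_(nlines A)) :
  bijective tau ->
  (forall i, steepness (lines A i) != 0) ->
  ambient_equivalent (Defs.support A)
    (slope_lines (fun i => slope (lines A (tau i)))
                 (fun i => intercept (lines A (tau i)))).
Proof.
move=> [tau' tauK tau'K] st0; exists shear; first exact: shear_homeomorphism.
apply/seteqP; split.
  move=> _ [p [i _ /shear_points pi] <-]; exists (tau' i); rewrite tau'K; exact: pi.
move=> q [i qi]; exists (unshear q); last exact: unshearK.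
exists (tau i) => //; apply/shear_points => //; rewrite unshearK; exact: qi.
Qed.

End Lines.

(** Each line excludes at most one value of [mu]; a large real number avoids
them all. *)
Lemma steep_shear (R : realType) (J : finType) (L : J -> line R) :
  exists mu, forall j, steepness mu (L j) != 0.
Proof.
have [M M1 MP] := finite_upper_bound (fun j => modulus (lb (L j) / la (L j))).
have [mu muP] : exists mu : C R, forall j, mu != lb (L j) / la (L j).
  exists ((M + 1)%:C%C : C R) => j; apply/negP => /eqP E.
  by have := MP j; rewrite -E modulus_real ger0_norm; lra.
exists mu => j; have := line_nondegenerate (L j); rewrite /steepness.
have [->|a0] := eqVneq (la (L j)) 0.
  by rewrite mulr0 subr0; apply: contraNneq => ->.
move=> _; apply: contraNneq (muP j) => /subr0_eq ->.
by rewrite mulfK.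
Qed.

(** * Topological equivalence of generic arrangements *)

Theorem theoremA (R : realType) (A0 A1 : arrangement R) :
  generic A0 -> generic A1 -> same_combinatorics A0 A1 ->
  topologically_equivalent A0 A1.
Proof.
move=> [triple0 _] [triple1 _] /same_combinatorics_matching[sigma sigma_bij sigmaE].
have [mu muP] := steep_shear (fun j : 'I_(nlines A0) + 'I_(nlines A1) =>
  match j with inl i => lines A0 i | inr i => lines A1 i end).
have st0 i : steepness mu (lines A0 i) != 0 by exact: (muP (inl i)).
have st1 i : steepness mu (lines A1 i) != 0 by exact: (muP (inr i)).
have sigma_inj := bij_inj sigma_bij.
pose e i k := direction (lines A0 i) == direction (lines A0 k).
have adm0 := admissible_lines (e := e) st0 (@lines_distinct _ A0) triple0
  (fun _ _ => erefl).
have adm1 : admissible e (fun i => slope mu (lines A1 (sigma i)))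
    (fun i => intercept mu (lines A1 (sigma i))).
  apply: (@admissible_lines _ mu _ e (fun i => lines A1 (sigma i))) => //.
  - by move=> i k /(@lines_distinct _ A1)/sigma_inj.
  - by move=> i j k; rewrite -(map_inj_uniq sigma_inj); exact: triple1.
have id_bij : bijective (@id 'I_(nlines A0)) by exists id.
apply: ambient_equivalent_trans (support_shear id_bij st0) _.
apply: ambient_equivalent_trans (slope_lines_equivalent adm0 adm1) _.
exact: ambient_equivalent_sym (support_shear sigma_bij st1).
Qed.
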